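(* Let $d,k\ge1$, let $A\in\mathbb C^{d\times d}$ be diagonalizable with purely imaginary eigenvalues, let $A_1=\operatorname{diag}\{A,0\}\in\mathbb C^{(d+1)\times(d+1)}$, and let $A_1^{[k]}(\hat{\mathbf x})$ be the matrix produced from $A_1$ by the $k$-th order local linear extension operation at a reference point $\hat{\mathbf x}$ (defined in the context). Then $A_1^{[k]}(\hat{\mathbf x})$ is diagonalizable, and all its eigenvalues have zero real parts.
   Context: Variables $\mathbf x=(x_1,\dots,x_{d+1})=[\mathbf u^\top,t]^\top$; a reference point is $\hat{\mathbf x}=[\hat{\mathbf u}^\top,\hat t]^\top$ with $\hat{\mathbf u}\in\mathbb C^d$, $\hat t\ge0$. For $j\ge0$ let $\tilde{\mathcal I}_{d+1}^{[[j]]}$ be the set of nondecreasing tuples $\alpha\in\{1,\dots,d+1\}^j$ (only the empty tuple if $j=0$), and $(\mathbf x-\hat{\mathbf x})^\alpha=\prod_{l=1}^j(x_{\alpha_l}-\hat x_{\alpha_l})$ (equal to $1$ for $j=0$). The vector $\mathbf x^{[k,\hat{\mathbf x}]}$ lists all polynomials $(\mathbf x-\hat{\mathbf x})^\alpha$, $\alpha\in\bigcup_{j=0}^k\tilde{\mathcal I}_{d+1}^{[[j]]}$, once each: first component $1$, next $d+1$ components $\mathbf x-\hat{\mathbf x}$, the rest in any fixed order. Its length is $D^{[k]}$. Let $D_1$ be the operator on polynomials $p(\mathbf x)$ given by $D_1(p)=\sum_{i,m=1}^{d+1}(A_1)_{im}x_m\,\partial p/\partial x_i$ (this is the $O(1/\varepsilon)$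 part of $\frac{\mathrm d}{\mathrm dt}$ along $\dot{\mathbf x}=\frac1\varepsilon A_1\mathbf x+\mathbf f(\mathbf x)$). The matrix $A_1^{[k]}(\hat{\mathbf x})\in\mathbb C^{D^{[k]}\times D^{[k]}}$ is the unique matrix with $$D_1\big(\mathbf x^{[k,\hat{\mathbf x}]}\big)=A_1^{[k]}(\hat{\mathbf x})\,\mathbf x^{[k,\hat{\mathbf x}]}$$ as polynomial identities in $\mathbf x$, $D_1$ acting componentwise. It is the coefficient matrix of the $O(1/\varepsilon)$ linear part in the system of ODEs satisfied by $\mathbf x^{[k,\hat{\mathbf x}]}$. *)

(* Defs.v *)
From HB Require Import structures.
From mathcomp Require Import all_boot all_order all_algebra.
From mathcomp Require Import reals.
From mathcomp Require Import complex mpoly.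

Set Implicit Arguments.
Unset Strict Implicit.
Unset Printing Implicit Defensive.

Import Order.TTheory GRing.Theory Num.Theory.
Local Open Scope ring_scope.

(* A multi-index of length j is a nondecreasing sequence of j elements of 'I_n
   (variables are numbered from 0); [::] is the empty tuple. *)
Definition nondecreasing_index (n : nat) (alpha : seq 'I_n) : bool :=
  sorted (fun i j : 'I_n => (i <= j)%N) alpha.

Definition multi_index (n k : nat) (alpha : seq 'I_n) : bool :=
  nondecreasing_index alpha && (size alpha <= k)%N.

(* An admissible ordering of the components of the extended vector: the
   constant comes first, then the n first-order terms in their natural order,
   and the others in an arbitrary order. *)
Definition index_ordering (n k D : nat) (s : D.-tuple (seq 'I_n)) : Prop :=
  [/\ uniq s,
      forall alpha : seq 'I_n, (alpha \in s) = multi_index k alpha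
    & prefix ([::] :: [seq [:: i] | i <- enum 'I_n]) s].

Section LocalLinearExtension.
Variables (K : fieldType) (n : nat).
Implicit Types (B : 'M[K]_n) (xhat : 'cV[K]_n) (p : {mpoly K[n]}).

Definition shifted_monomial xhat (alpha : seq 'I_n) : {mpoly K[n]} :=
  \prod_(i <- alpha) ('X_i - (xhat i 0)%:MP).

Definition extended_vector xhat (D : nat) (s : D.-tuple (seq 'I_n)) :
    'cV[{mpoly K[n]}]_D :=
  \col_(i < D) shifted_monomial xhat (tnth s i).

Definition linear_vector_field_op B p : {mpoly K[n]} :=
  \sum_(i < n) \sum_(m < n) B i m *: ('X_m * p^`M(i)).

(* This determines M uniquely, see local_linear_extension_unique_exists. *)
Definition local_linear_extension B xhat (D : nat)
    (s : D.-tuple (seq 'I_n)) (M : 'M[K]_D) : Prop :=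
  map_mx (linear_vector_field_op B) (extended_vector xhat s)
    = map_mx (@mpolyC n K) M *m extended_vector xhat s.

Local Notation Dop := linear_vector_field_op.

Lemma linear_vector_field_opM B p q : Dop B (p * q) = Dop B p * q + p * Dop B q.
Proof.
rewrite /Dop mulr_suml mulr_sumr -big_split /=; apply: eq_bigr => i _.
rewrite mulr_suml mulr_sumr -big_split /=; apply: eq_bigr => m _.
by rewrite mderivM mulrDr scalerDr -scalerAl -scalerAr !mulrA [p * _]mulrC.
Qed.

Lemma linear_vector_field_opX B xhat i :
  Dop B ('X_i - (xhat i 0)%:MP) = \sum_(m < n) B i m *: 'X_m.
Proof.
rewrite /Dop (bigD1 i) //= [X in _ + X]big1 ?addr0 => [|j ji].
  apply: eq_bigr => m _; rewrite mderivB mderivC subr0 mderivX mnm1E eqxx.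
  have -> : (U_(i) - U_(i) = 0 :> 'X_{1..n})%MM.
    by apply/mnmP => j; rewrite mnmBE mnm0E subnn.
  by rewrite mpolyX0 scale1r mulr1.
apply: big1 => m _.
by rewrite mderivB mderivC subr0 mderivX mnm1E eq_sym (negPf ji) scale0r mulr0 scaler0.
Qed.

Lemma shifted_monomial_cons xhat i alpha :
  shifted_monomial xhat (i :: alpha)
    = ('X_i - (xhat i 0)%:MP) * shifted_monomial xhat alpha.
Proof. by rewrite /shifted_monomial big_cons. Qed.

Lemma shifted_monomial_cat xhat alpha beta :
  shifted_monomial xhat (alpha ++ beta)
    = shifted_monomial xhat alpha * shifted_monomial xhat beta.
Proof. by rewrite /shifted_monomial big_cat. Qed.

Section Existence.
Variables (B : 'M[K]_n) (xhat : 'cV[K]_n) (k D : nat) (s : D.-tuple (seq 'I_n)).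
Hypothesis s_ord : index_ordering k s.

Local Notation mon := (shifted_monomial xhat).

Let in_span p := exists r : 'I_D -> K, p = \sum_j r j *: mon (tnth s j).

Let in_spanD p q : in_span p -> in_span q -> in_span (p + q).
Proof.
move=> [r ->] [r' ->]; exists (fun j => r j + r' j).
by rewrite -big_split /=; apply: eq_bigr => j _; rewrite scalerDl.
Qed.

Let in_span0 : in_span 0.
Proof. by exists (fun=> 0); rewrite big1 // => j _; rewrite scale0r. Qed.

Let in_spanZ a p : in_span p -> in_span (a *: p).
Proof.
move=> [r ->]; exists (fun j => a * r j).
by rewrite scaler_sumr; apply: eq_bigr => j _; rewrite scalerA.
Qed.

Let in_span_mon beta : (size beta <= k)%N -> in_span (mon beta).
Proof.
move=> sb; case: s_ord => _ s_in _.
pose le (i j : 'I_n) := (i <= j)%N.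
have : sort le beta \in s.
  rewrite s_in /multi_index size_sort sb andbT.
  by apply: sort_sorted => i j; apply: leq_total.
case/tnthP=> j0 sj0; exists (fun j => (j == j0)%:R).
rewrite (bigD1 j0) //= eqxx scale1r -sj0 big1 ?addr0 => [|j /negPf->].
  by apply: perm_big; rewrite perm_sym perm_sort.
by rewrite scale0r.
Qed.

Let in_span_op alpha beta : (size alpha + size beta <= k)%N ->
  in_span (Dop B (mon alpha) * mon beta).
Proof.
elim: alpha beta => [|i alpha IH] beta /= sab.
  rewrite /shifted_monomial big_nil /Dop big1 ?mul0r // => i _; apply: big1 => m _.
  by rewrite -mpolyC1 mderivC mulr0 scaler0.
rewrite shifted_monomial_cons linear_vector_field_opM mulrDl.
apply: in_spanD; last first.
  rewrite -mulrA mulrCA -shifted_monomial_cons.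
  by apply: IH; rewrite /= addnS.
rewrite linear_vector_field_opX -mulrA mulr_suml -shifted_monomial_cat.
elim/big_ind: _ => [|p q|m _]; [exact: in_span0|exact: in_spanD|].
rewrite -scalerAl; apply: in_spanZ.
rewrite -['X_m](subrK (xhat m 0)%:MP) mulrDl -shifted_monomial_cons.
apply: in_spanD; first by apply: in_span_mon; rewrite /= size_cat.
rewrite mul_mpolyC; apply: in_spanZ; apply: in_span_mon.
by rewrite size_cat; apply: ltnW.
Qed.

Let mnm_of (alpha : seq 'I_n) : 'X_{1..n} := [multinom count_mem i alpha | i < n].

Let mnm_of_inj (alpha beta : seq 'I_n) :
  nondecreasing_index alpha -> nondecreasing_index beta ->
  mnm_of alpha = mnm_of beta -> alpha = beta.
Proof.
move=> sa sb eq_ab.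
apply: (@sorted_eq _ (fun i j : 'I_n => (i <= j)%N)) => //.
- by move=> i j l; apply: leq_trans.
- by move=> i j /anti_leq /val_inj.
apply/allP => i _ /=; apply/eqP.
by move/(congr1 (fun m : 'X_{1..n} => m i)): eq_ab; rewrite !mnmE.
Qed.

Let shift_mon alpha :
  mon alpha \mPo [tuple 'X_i + (xhat i 0)%:MP | i < n] = 'X_[mnm_of alpha].
Proof.
elim: alpha => [|i alpha IH].
  have -> : mnm_of [::] = 0%MM by apply/mnmP => i; rewrite !mnmE.
  by rewrite /shifted_monomial big_nil rmorph1 mpolyX0.
have -> : mnm_of (i :: alpha) = (U_(i) + mnm_of alpha)%MM.
  by apply/mnmP => j; rewrite mnmDE !mnmE.
rewrite shifted_monomial_cons rmorphM /= IH rmorphB /= comp_mpolyXU comp_mpolyC.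
by rewrite -tnth_nth tnth_mktuple addrK mpolyXD.
Qed.

Let mon_free (r : 'I_D -> K) :
  \sum_j r j *: mon (tnth s j) = 0 -> forall j, r j = 0.
Proof.
case: s_ord => s_uniq s_in _ + j.
move/(congr1 (comp_mpoly [tuple 'X_i + (xhat i 0)%:MP | i < n])).
rewrite rmorph0 rmorph_sum /= => /(congr1 (mcoeff (mnm_of (tnth s j)))).
rewrite mcoeff0 raddf_sum /= (bigD1 j) //= comp_mpolyZ shift_mon mcoeffZ mcoeffX eqxx.
rewrite mulr1 big1 ?addr0 // => l lj.
rewrite comp_mpolyZ shift_mon mcoeffZ mcoeffX; case: eqP => [eq_lj|_]; last exact: mulr0.
have nd m : nondecreasing_index (tnth s m).
  by have := mem_tnth m s; rewrite s_in => /andP[].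
have eq_l : tnth s l = tnth s j by exact: mnm_of_inj.
by move/tuple_uniqP: s_uniq => /(_ _ _ eq_l) eq_lj'; rewrite eq_lj' eqxx in lj.
Qed.

Lemma local_linear_extension_unique_exists :
  exists! M : 'M[K]_D, local_linear_extension B xhat s M.
Proof.
have sizes i : (size (tnth s i) <= k)%N.
  by case: s_ord => _ s_in _; have := mem_tnth i s; rewrite s_in => /andP[].
have rowE i : exists r : {ffun 'I_D -> K},
    Dop B (mon (tnth s i)) == \sum_j r j *: mon (tnth s j).
  have := @in_span_op (tnth s i) [::].
  rewrite addn0 [mon [::]]big_nil mulr1 => /(_ (sizes i)) [r ->].
  by exists (finfun r); apply/eqP/eq_bigr => j _; rewrite ffunE.
exists (\matrix_(i, j) xchoose (rowE i) j); split.
  apply/matrixP => i z; rewrite !mxE (eqP (xchooseP (rowE i))).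
  by apply: eq_bigr => j _; rewrite !mxE mul_mpolyC.
move=> M /matrixP extM; apply/matrixP => i j; rewrite mxE; apply/eqP.
rewrite -subr_eq0; apply/eqP.
apply: (mon_free (r := fun j => xchoose (rowE i) j - M i j)).
under eq_bigr do rewrite scalerBl.
rewrite sumrB -(eqP (xchooseP (rowE i))); have := extM i 0; rewrite !mxE => ->.
apply/eqP; rewrite subr_eq0; apply/eqP/eq_bigr => l _.
by rewrite !mxE mul_mpolyC.
Qed.

End Existence.
End LocalLinearExtension.

Lemma index_ordering_exists (n k : nat) : (0 < k)%N ->
  exists (D : nat) (s : D.-tuple (seq 'I_n)), index_ordering k s.
Proof.
move=> k_gt0.
pose low : seq (seq 'I_n) := [::] :: [seq [:: i] | i <- enum 'I_n].
pose all_ := flatten [seq [seq tval t | t <- enum {: j.-tuple 'I_n}] | j <- iota 0 k.+1].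
pose high := [seq a <- undup all_ | nondecreasing_index a & a \notin low].
exists (size (low ++ high)), (in_tuple (low ++ high)).
have low_uniq : uniq low.
  rewrite /low cons_uniq map_inj_uniq ?enum_uniq ?andbT => [|i j [] //].
  by apply/negP => /mapP[].
have lowP a : a \in low -> multi_index k a.
  by rewrite inE => /orP[/eqP->|/mapP[i _ ->]]; rewrite /multi_index /=.
split; last exact: prefix_prefix.
- rewrite cat_uniq low_uniq filter_uniq ?undup_uniq // andbT andTb.
  by apply/hasPn => a; rewrite mem_filter => /andP[/andP[]].
move=> a; rewrite mem_cat; case: (boolP (a \in low)) => [/lowP-> //|a_low] /=.
rewrite mem_filter a_low andbT mem_undup /multi_index; congr (_ && _).
apply/flatten_mapP/idP => [[j]|sa].
  by rewrite mem_iota add0n => /andP[_ jk] /mapP[t _ ->]; rewrite size_tuple.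
exists (size a); first by rewrite mem_iota add0n ltnS.
by apply/mapP; exists (in_tuple a); rewrite ?mem_enum.
Qed.

(* Main.v *)
(* The derivation p |-> D_1 p sends the linear form u x to (u A_1) x, so left
   eigenvectors of A_1 give linear forms that are eigenvectors of D_1. By the
   Leibniz rule a product of eigenvectors is an eigenvector whose eigenvalue is
   the sum of the eigenvalues of the factors. Hence every shifted monomial is a
   finite sum of eigenvectors of D_1 with purely imaginary eigenvalues, and some
   product of distinct factors (X - c), with c imaginary, evaluated at D_1 kills
   all of them. The shifted monomials being linearly independent, the same
   polynomial kills the matrix of D_1. *)
Require Import Defs.
From HB Require Import structures.
From mathcomp Require Import all_boot all_order all_algebra.
From mathcomp Require Import reals.
From mathcomp Require Import complex mpoly.

Set Implicit Arguments.
Unset Strict Implicit.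
Unset Printing Implicit Defensive.

Import Order.TTheory GRing.Theory Num.Theory.
Local Open Scope ring_scope.

(** * Left eigenvectors and the block matrix [diag(A, 0)] *)

Section Diagonalizable.
Variable K : fieldType.

Lemma diagonalizable_eigenrows n (A : 'M[K]_n) : diagonalizable A ->
  exists (P : 'M[K]_n) (d : 'rV[K]_n),
    [/\ P \in unitmx, P *m A = diag_mx d *m P
      & forall i, eigenvalue A (d 0 i)].
Proof.
case=> P Punit /diagonalizable_forPex[d /(simmxP Punit) PA].
exists P, d; split => // i; apply/eigenvalueP; exists (row i P).
  by rewrite -row_mul PA row_mul row_diag_mx -scalemxAl -rowE.
(* A zero row of [P] would make a row of [P *m Q = 1] vanish. *)
apply: contraTneq Punit => Pi0; rewrite -row_free_unit.
apply/negP => /row_freeP[Q PQ].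
move/(congr1 (fun N => N *m Q)): Pi0; rewrite -row_mul PQ mul0mx.
by move/matrixP/(_ 0 i)/eqP; rewrite !mxE eqxx oner_eq0.
Qed.

Lemma diagonalizable_block0 m n (A : 'M[K]_m) : diagonalizable A ->
  diagonalizable (block_mx A 0 0 0 : 'M_(m + n)).
Proof.
case/diagonalizable_eigenrows=> P [d [Punit PA _]].
have Qunit : block_mx P 0 0 1%:M \in @unitmx K (m + n).
  by rewrite unitmxE det_ublock det1 mulr1 -unitmxE.
exists (block_mx P 0 0 1%:M) => //.
apply/diagonalizable_forPex; exists (row_mx d 0); apply/(simmxP Qunit).
rewrite diag_mx_row !mulmx_block !mulmx0 !mul0mx !addr0 !add0r PA.
by rewrite mulmx1 raddf0.
Qed.

(** A left eigenvector [(u1, u2)] is sent to [(u1 A, 0)], so [a u2 = 0]. If [u2 = 0], then [u1] is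
    nonzero and is an eigenvector of [A]. *)
Lemma eigenvalue_block0 m n (A : 'M[K]_m) a :
  eigenvalue (block_mx A 0 0 0 : 'M_(m + n)) a -> eigenvalue A a \/ a = 0.
Proof.
case/eigenvalueP=> u; rewrite -[u]hsubmxK mul_row_block !mulmx0 !addr0.
rewrite scale_row_mx => /eq_row_mx[uA /esym/eqP].
rewrite scaler_eq0 => /orP[/eqP|/eqP ->]; first by right.
move=> u0; left; apply/eigenvalueP; exists (lsubmx u) => //.
by apply: contraNneq u0 => ->; rewrite row_mx0.
Qed.

End Diagonalizable.

(** * Sums of eigenvectors of the derivation on polynomials *)

Section EigenSum.
Variables (K : fieldType) (n : nat) (B : 'M[K]_n).
Variables (S : {pred K}) (S_add : GRing.nmod_closed S).

Local Notation Dop := (linear_vector_field_op B).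

Fact linear_vector_field_op_is_linear : linear Dop.
Proof.
move=> a p q; rewrite /linear_vector_field_op scaler_sumr -big_split /=.
apply: eq_bigr => i _; rewrite scaler_sumr -big_split /=; apply: eq_bigr => m _.
by rewrite mderivD mderivZ mulrDr -scalerAr scalerDr !scalerA [a * _]mulrC.
Qed.

HB.instance Definition _ :=
  GRing.isLinear.Build K {mpoly K[n]} {mpoly K[n]} _ Dop
    linear_vector_field_op_is_linear.

(** Each summand carries its eigenvalue. Zero summands and repeated eigenvalues are allowed, so sums
    and products need no normalization. *)
Definition eigen_sum (p : {mpoly K[n]}) : Prop :=
  exists2 l : seq (K * {mpoly K[n]}),
    forall u, u \in l -> u.1 \in S /\ Dop u.2 = u.1 *: u.2
  & p = \sum_(u <- l) u.2.

Lemma eigen_sum_eigen a p : a \in S -> Dop p = a *: p -> eigen_sum p.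
Proof.
by move=> Sa Dp; exists [:: (a, p)]; [move=> u /[1!inE] /eqP -> | rewrite big_seq1].
Qed.

Lemma eigen_sum0 : eigen_sum 0.
Proof. by exists [::]; rewrite ?big_nil. Qed.

Lemma eigen_sumD p q : eigen_sum p -> eigen_sum q -> eigen_sum (p + q).
Proof.
case=> l hl -> [l' hl' ->]; exists (l ++ l'); last by rewrite big_cat.
by move=> u; rewrite mem_cat => /orP[/hl|/hl'].
Qed.

Lemma eigen_sum_sum I (r : seq I) (P : pred I) (F : I -> {mpoly K[n]}) :
  (forall i, P i -> eigen_sum (F i)) -> eigen_sum (\sum_(i <- r | P i) F i).
Proof. exact: (big_ind _ eigen_sum0 eigen_sumD). Qed.

Lemma eigen_sumC a : eigen_sum a%:MP.
Proof.
apply: (@eigen_sum_eigen 0); first by case: S_add.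
rewrite scale0r /linear_vector_field_op big1 // => i _; apply: big1 => m _.
by rewrite mderivC mulr0 scaler0.
Qed.

Lemma eigen_sumM p q : eigen_sum p -> eigen_sum q -> eigen_sum (p * q).
Proof.
case=> l hl -> [l' hl' ->]; rewrite mulr_suml big_seq.
apply: eigen_sum_sum => u /hl[Su Du]; rewrite mulr_sumr big_seq.
apply: eigen_sum_sum => v /hl'[Sv Dv].
apply: (@eigen_sum_eigen (u.1 + v.1)); first by case: S_add => _; apply.
by rewrite linear_vector_field_opM Du Dv -scalerAl -scalerAr scalerDl.
Qed.

Lemma linear_vector_field_op_form (u : 'rV[K]_n) :
  Dop (\sum_i u 0 i *: 'X_i) = \sum_i (u *m B) 0 i *: 'X_i.
Proof.
have DX i : Dop 'X_i = \sum_m B i m *: 'X_m.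
  by have := linear_vector_field_opX B 0 i; rewrite mxE mpolyC0 subr0.
rewrite linear_sum /=; under eq_bigr do rewrite linearZ /= DX scaler_sumr.
rewrite exchange_big /=; apply: eq_bigr => m _; rewrite mxE scaler_suml.
by apply: eq_bigr => i _; rewrite scalerA.
Qed.

Hypothesis B_diag : diagonalizable B.
Hypothesis B_eigen : forall a, eigenvalue B a -> a \in S.

Lemma eigen_sumX i : eigen_sum 'X_i.
Proof.
have [P [d [Punit PB eigd]]] := diagonalizable_eigenrows B_diag.
(* This is [x = P^-1 (P x)]: the rows of [P] give eigenforms, and the entries of [P^-1] enter as
   constant polynomials, which are eigenvectors for 0. *)
have -> : 'X_i = \sum_r (invmx P i r)%:MP * \sum_m row r P 0 m *: 'X_m
    :> {mpoly K[n]}.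
  under eq_bigr do rewrite mul_mpolyC scaler_sumr.
  rewrite exchange_big (bigD1 i) //= [X in _ + X]big1 ?addr0 => [|m mi].
    under eq_bigr do rewrite mxE scalerA.
    have := congr1 (fun N : 'M_n => N i i) (mulVmx Punit).
    by rewrite !mxE eqxx -scaler_suml => ->; rewrite scale1r.
  under eq_bigr do rewrite mxE scalerA.
  have := congr1 (fun N : 'M_n => N i m) (mulVmx Punit).
  by rewrite !mxE eq_sym (negPf mi) -scaler_suml => ->; rewrite scale0r.
apply: eigen_sum_sum => r _; apply: eigen_sumM; first exact: eigen_sumC.
apply: (eigen_sum_eigen (B_eigen (eigd r))).
rewrite linear_vector_field_op_form -row_mul PB row_mul row_diag_mx.
rewrite -scalemxAl -rowE scaler_sumr.
by apply: eq_bigr => m _; rewrite mxE scalerA.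
Qed.

Lemma eigen_sum_shifted_monomial xhat alpha :
  eigen_sum (shifted_monomial xhat alpha).
Proof.
rewrite /shifted_monomial; apply: big_ind => [|p q|i _].
- by rewrite -mpolyC1; apply: eigen_sumC.
- exact: eigen_sumM.
by rewrite -mpolyCN; apply: eigen_sumD (eigen_sumX i) (eigen_sumC _).
Qed.

(** The product of the [X - c], [c] in [rs], evaluated at the operator and applied to [p]. *)
Definition shifted_ops (rs : seq K) (p : {mpoly K[n]}) : {mpoly K[n]} :=
  foldr (fun c q => Dop q - c *: q) p rs.

Lemma shifted_ops_sum rs I (r : seq I) (F : I -> {mpoly K[n]}) :
  shifted_ops rs (\sum_(i <- r) F i) = \sum_(i <- r) shifted_ops rs (F i).
Proof.
elim: rs => //= c rs ->.
by rewrite linear_sum scaler_sumr -sumrB.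
Qed.

Lemma shifted_ops_eigen rs a p : a \in rs -> Dop p = a *: p ->
  shifted_ops rs p = 0.
Proof.
(* On an eigenvector each factor acts as the scalar [a - c], and [c = a] occurs. *)
move=> ars Dp; have -> : shifted_ops rs p = (\prod_(c <- rs) (a - c)) *: p.
  elim: rs {ars} => [|c rs /= ->]; first by rewrite big_nil scale1r.
  by rewrite linearZ /= Dp big_cons !scalerA -scalerBl mulrBl [_ * a]mulrC.
by rewrite (big_rem a ars) /= subrr mul0r scale0r.
Qed.

End EigenSum.

Lemma sub_eigen_sum (K : fieldType) n (B : 'M[K]_n) (S T : {pred K}) p :
  {subset S <= T} -> eigen_sum B S p -> eigen_sum B T p.
Proof. by move=> ST [l lS ->]; exists l => // u /lS[/ST]. Qed.

(** Finitely many finite sums involve finitely many eigenvalues; these become the roots of one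
    annihilating polynomial. *)
Lemma eigen_sum_finite (K : fieldType) n (B : 'M[K]_n) (S : {pred K})
    (r : seq {mpoly K[n]}) :
  (forall p, p \in r -> eigen_sum B S p) ->
  exists2 rs : seq K,
    {subset rs <= S} & forall p, p \in r -> eigen_sum B [pred a | a \in rs] p.
Proof.
elim: r => [|p r IH] Er; first by exists [::].
have [q qr|rs rsS rsr] := IH; first by apply: Er; rewrite inE qr orbT.
have [l lS pE] := Er p (mem_head _ _).
exists (map fst l ++ rs) => [a|q].
  by rewrite mem_cat => /orP[/mapP[u /lS[Su _] ->]|/rsS].
rewrite inE => /orP[/eqP->|/rsr]; last first.
  by apply: sub_eigen_sum => a; rewrite !inE mem_cat => ->; rewrite orbT.
exists l => // u ul; have [_ Du] := lS u ul; split => //.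
by rewrite inE mem_cat map_f.
Qed.

Lemma shifted_ops_eigen_sum (K : fieldType) n (B : 'M[K]_n) (rs : seq K) p :
  eigen_sum B [pred a | a \in rs] p -> shifted_ops B rs p = 0.
Proof.
case=> l lrs ->; rewrite shifted_ops_sum big_seq big1 // => u /lrs[urs].
exact: shifted_ops_eigen.
Qed.

(** * Transfer from the derivation to the extension matrix *)

Section Extension.
Variables (K : fieldType) (n : nat) (B : 'M[K]_n) (xhat : 'cV[K]_n).

Lemma shifted_ops_extension D (s : D.+1.-tuple (seq 'I_n)) (M : 'M[K]_D.+1) rs :
  local_linear_extension B xhat s M ->
  map_mx (@mpolyC n K) (horner_mx M (\prod_(c <- rs) ('X - c%:P)))
      *m extended_vector xhat s
    = map_mx (shifted_ops B rs) (extended_vector xhat s).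
Proof.
rewrite /local_linear_extension; move: (extended_vector xhat s) => v M_ext.
elim: rs => [|c rs IH].
  by rewrite big_nil rmorph1 map_mx1 mul1mx map_mx_id.
(* The new factor [M - c] is placed next to [v], where [M v] is the derivative of [v]; the constant
   matrix [N] then commutes with the derivation. *)
rewrite big_cons mulrC rmorphM rmorphB /= horner_mx_X horner_mx_C.
set N := horner_mx _ _ in IH *.
rewrite -mulmxE map_mxM -mulmxA map_mxB mulmxBl -M_ext.
apply/matrixP => i j; rewrite [RHS]mxE /= -/(shifted_ops _ _ _).
have -> : shifted_ops B rs (v i j) = (map_mx (@mpolyC n K) N *m v) i j.
  by rewrite IH mxE.
rewrite map_scalar_mx mul_scalar_mx !mxE linear_sum /= scaler_sumr -sumrB.
apply: eq_bigr => l _; rewrite !mxE !mul_mpolyC scalerBr !scalerA [c * _]mulrC.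
by rewrite [linear_vector_field_op B (_ *: _)]linearZ.
Qed.

Lemma extended_vector_free k D (s : D.-tuple (seq 'I_n)) (N : 'M[K]_D) :
  index_ordering k s ->
  map_mx (@mpolyC n K) N *m extended_vector xhat s = 0 -> N = 0.
Proof.
move=> s_ord N0.
(* [N] and [0] both represent the zero vector field. *)
have Dop0 : map_mx (linear_vector_field_op 0) (extended_vector xhat s) = 0.
  apply/matrixP => i j; rewrite !mxE /linear_vector_field_op.
  by rewrite big1 // => l _; rewrite big1 // => m _; rewrite mxE scale0r.
have [N' [_ uniqN']] := local_linear_extension_unique_exists 0 xhat s_ord.
have <- : N' = N by apply: uniqN'; rewrite /local_linear_extension N0.
by apply: uniqN'; rewrite /local_linear_extension Dop0 map_mx0 mul0mx.
Qed.

Lemma local_linear_extension_diagonalizable (S : {pred K}) k D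
    (s : D.-tuple (seq 'I_n)) (M : 'M[K]_D) :
  GRing.nmod_closed S -> diagonalizable B ->
  (forall a, eigenvalue B a -> a \in S) ->
  index_ordering k s -> local_linear_extension B xhat s M ->
  diagonalizable M /\ forall a, eigenvalue M a -> a \in S.
Proof.
move=> S_add B_diag B_eigen; case: D => [|D] in s M *.
  (* [D = 0] is impossible, since an admissible ordering starts with the empty index. *)
  case=> _ _ /prefixP[t st]; have := size_tuple s.
  by rewrite st.
move=> s_ord M_ext.
have [|rs0 rs0S rs0E] := @eigen_sum_finite _ _ B S
    [seq shifted_monomial xhat alpha | alpha <- s].
  by move=> _ /mapP[alpha _ ->]; apply: eigen_sum_shifted_monomial.
(* Removing repetitions makes the roots simple, as the minimal polynomial criterion for
   diagonalizability demands. *)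
pose rs := undup rs0.
have min_dvd : mxminpoly M %| \prod_(c <- rs) ('X - c%:P).
  apply: mxminpoly_min; apply: (extended_vector_free s_ord).
  rewrite (shifted_ops_extension _ M_ext).
  apply/matrixP => i j; rewrite !mxE shifted_ops_eigen_sum //.
  apply: sub_eigen_sum (rs0E _ (map_f _ (mem_tnth i s))) => a.
  by rewrite !inE mem_undup.
split=> [|a]; first by apply/diagonalizableP; exists rs; rewrite ?undup_uniq.
rewrite eigenvalue_root_min -dvdp_XsubCl => /dvdp_trans/(_ min_dvd).
by rewrite dvdp_XsubCl root_prod_XsubC mem_undup => /rs0S.
Qed.

End Extension.

Theorem proposition3p1 (R : realType) (d k : nat) (hd : (0 < d)%N) (hk : (0 < k)%N)
    (A : 'M[R[i]]_d) (A_diag : diagonalizable A)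
    (A_imag : forall a : R[i], eigenvalue A a -> complex.Re a = 0)
    (uhat : 'cV[R[i]]_d) (that : R) (that_ge0 : 0 <= that)
    (D : nat) (s : D.-tuple (seq 'I_(d + 1))) (s_ord : index_ordering k s)
    (M : 'M[R[i]]_D)
    (M_ext : local_linear_extension (block_mx A 0 0 0 : 'M[R[i]]_(d + 1))
               (col_mx uhat (that%:C)%C%:M) s M) :
  diagonalizable M /\ (forall a : R[i], eigenvalue M a -> complex.Re a = 0).
Proof.
(* The imaginary axis contains 0 and is closed under addition, so it absorbs the eigenvalues of
   constants and products, and that of the zero block. *)
pose S : {pred R[i]} := [pred a | complex.Re a == 0].
have S_add : GRing.nmod_closed S.
  split=> [|a b]; first by rewrite inE.
  by rewrite !inE raddfD /= => /eqP-> /eqP->; rewrite addr0.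
have B_eigen a : eigenvalue (block_mx A 0 0 0 : 'M_(d + 1)) a -> a \in S.
  by case/eigenvalue_block0 => [/A_imag Re_a|->]; rewrite inE ?Re_a.
have [M_diag M_eigen] := local_linear_extension_diagonalizable S_add
  (diagonalizable_block0 1 A_diag) B_eigen s_ord M_ext.
by split=> // a /M_eigen /eqP.
Qed.
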